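(* Let $X$ be a real vector space and let $C\subseteq X$ be a convex set. Then \[ \operatorname{icr} C = \{x\in C \mid F_{\min}(x,C)=C\}, \] where $\operatorname{icr} C$ is the intrinsic core of $C$ and $F_{\min}(x,C)$ is the minimal face of $C$ containing $x$.
   Context: For $y,z\in X$, the open segment is $(y,z)=\{ty+(1-t)z \mid t\in(0,1)\}$; the degenerate case $(y,y)=\{y\}$ is allowed. A face of a convex set $C$ is a convex subset $F\subseteq C$ (possibly empty or equal to $C$) such that for every $x\in F$ and all $y,z\in C$ with $x\in(y,z)$ we have $y,z\in F$. For $x\in C$, $F_{\min}(x,C)$ denotes the intersection of all faces of $C$ that contain $x$. The intrinsic core of a convex set $C$ is $\operatorname{icr} C=\{x\in C \mid \forall y\in C\ \exists z\in C \text{ such that } x\in(y,z)\}$. *)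

(* Defs.v *)
From mathcomp Require Import all_boot all_order all_algebra.
From mathcomp Require Import boolp classical_sets reals convex.

Set Implicit Arguments.
Unset Strict Implicit.
Unset Printing Implicit Defensive.

Import Order.TTheory GRing.Theory Num.Theory.

Local Open Scope classical_set_scope.
Local Open Scope ring_scope.

Section Faces.
Variables (R : realType) (X : lmodType R).
Implicit Types (C F : set X) (x y z : X).

(* When [y = z] this is the singleton [set y], not the empty set. *)
Definition open_segment y z : set X :=
  [set x | exists2 t : R, 0 < t < 1 & x = t *: y + (1 - t) *: z].

Definition is_face C F : Prop :=
  [/\ convex_set F, F `<=` C &
      forall x y z, F x -> C y -> C z -> open_segment y z x -> F y /\ F z].

Definition min_face x C : set X :=
  \bigcap_(F in [set F | is_face C F /\ F x]) F.

Definition icr C : set X :=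
  [set x | C x /\ forall y, C y -> exists2 z, C z & open_segment y z x].

End Faces.

(* Main.v *)
(** If [x] is in the intrinsic core, every face through [x] swallows each
    [y] in [C], because [x] lies in some open segment [(y, z)] of [C].
    Conversely, the points [y] of [C] for which such a [z] exists form a face
    of [C] containing [x]; if the minimal face is [C], that face is [C] too,
    which says precisely that [x] is in the intrinsic core. *)

Require Import Defs.
From mathcomp Require Import all_boot all_order all_algebra.
From mathcomp Require Import boolp classical_sets reals convex.
From mathcomp Require Import interval_inference ring lra.

Local Open Scope classical_set_scope.
Local Open Scope ring_scope.

Import Order.TTheory GRing.Theory Num.Theory.

Lemma convex_set_openP (R : realType) (X : lmodType R) (C : set X) :
  convex_set C <->
  (forall y z (t : R), C y -> C z -> 0 < t < 1 -> C (t *: y + (1 - t) *: z)).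
Proof.
split=> [Cconv y z t Cy Cz /andP[t0 t1]|Copen].
  have := Cconv y z (Itv01 (ltW t0) (ltW t1)).
  by rewrite !inE; apply.
apply/convex_setW => y z; rewrite !inE => Cy Cz k k0 k1.
by rewrite inE; apply: Copen => //; rewrite k0.
Qed.

(** The witness is the barycentre of [z1] and [z2] with weights [b1] and [b2]. Leaving the weights
    unnormalised spares callers any division. *)
Lemma open_segment_sum3 (R : realType) (X : lmodType R) (C : set X)
    (x y z1 z2 : X) (a b1 b2 : R) :
  convex_set C -> C z1 -> C z2 -> 0 < a -> 0 < b1 -> 0 < b2 ->
  (a + (b1 + b2)) *: x = a *: y + (b1 *: z1 + b2 *: z2) ->
  exists2 z, C z & open_segment y z x.
Proof.
move=> /convex_set_openP Cconv Cz1 Cz2 a0 b10 b20 xE.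
have b0 : 0 < b1 + b2 by exact: addr_gt0.
have s0 : 0 < a + (b1 + b2) by exact: addr_gt0.
pose t := b1 / (b1 + b2).
exists (t *: z1 + (1 - t) *: z2).
  by apply: Cconv => //; rewrite /t divr_gt0//= ltr_pdivrMr// mul1r ltrDl.
exists (a / (a + (b1 + b2))).
  by rewrite divr_gt0//= ltr_pdivrMr// mul1r ltrDl.
apply: (scalerI (lt0r_neq0 s0)); rewrite xE !scalerDr !scalerA.
by congr (_ *: _ + (_ *: _ + _ *: _)); rewrite /t; field; rewrite ?lt0r_neq0.
Qed.

(** Convexity and the face property both reduce to writing [x] as a positive combination of the
    point under test and two points of [C], which [open_segment_sum3] merges into one. *)
Lemma open_segment_extendible_face (R : realType) (X : lmodType R) (C : set X)
    (x : X) :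
  convex_set C ->
  is_face C [set y | C y /\ exists2 z, C z & open_segment y z x].
Proof.
move=> Cconv; have /convex_set_openP CP := Cconv; split=> [|y []//|].
- apply/convex_set_openP => y1 y2 l [Cy1 [z1 Cz1 [t1 t1P xE1]]].
  move=> [Cy2 [z2 Cz2 [t2 t2P xE2]]] lP; split; first exact: CP.
  move: t1P t2P lP => /andP[t10 t11] /andP[t20 t21] /andP[l0 l1].
  have t10' : 0 < 1 - t1 by lra.
  have t20' : 0 < 1 - t2 by lra.
  have l0' : 0 < 1 - l by lra.
  (* Weighting the first expression of [x] by [l t2] and the second by
     [(1 - l) t1] makes [y1] and [y2] appear in the ratio [l : 1 - l]. *)
  apply: (@open_segment_sum3 _ _ _ _ _ z1 z2 (t1 * t2)
    (l * t2 * (1 - t1)) ((1 - l) * t1 * (1 - t2))) => //; rewrite ?mulr_gt0//.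
  have -> : t1 * t2 + (l * t2 * (1 - t1) + (1 - l) * t1 * (1 - t2)) =
    l * t2 + (1 - l) * t1 by ring.
  rewrite scalerDl {1}xE1 xE2 !scalerDr !scalerA addrACA.
  by congr (_ *: _ + _ *: _ + _); ring.
(* Substituting [u] into the expression of [x] leaves positive weights on [y], [z] and [w]. The
   other endpoint follows by reversing the segment. *)
- have faceL u y z : C y -> C z -> open_segment y z u ->
      (exists2 w, C w & open_segment u w x) ->
      exists2 w, C w & open_segment y w x.
    move=> Cy Cz [s /andP[s0 s1] uE] [w Cw [t /andP[t0 t1] xE]].
    have s0' : 0 < 1 - s by lra.
    have t0' : 0 < 1 - t by lra.
    apply: (@open_segment_sum3 _ _ _ _ _ z w (t * s) (t * (1 - s)) (1 - t));
      rewrite ?mulr_gt0//.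
    have -> : t * s + (t * (1 - s) + (1 - t)) = 1 by ring.
    by rewrite scale1r xE uE scalerDr !scalerA addrA.
  move=> u y z [Cu uw] Cy Cz yzu; split; split=> //; first exact: (faceL u y z).
  apply: (faceL u z y) => //.
  move: yzu => [s /andP[s0 s1] uE].
  exists (1 - s); first by rewrite subr_gt0 s1 gtrBl.
  by rewrite uE subKr addrC.
Qed.

Theorem proposition3p11 (R : realType) (X : lmodType R) (C : set X)
    (hC : convex_set C) :
  icr C = [set x | C x /\ min_face x C = C].
Proof.
apply/seteqP; split=> x [Cx xP]; split=> //.
  (* [C] is a face of itself, so it contains the minimal face. *)
  apply/seteqP; split=> [y /(_ C)|y Cy F [[_ _ Fface] Fx]].
    by apply; split=> //; split.
  by have [z Cz xyz] := xP y Cy; have [] := Fface x y z Fx Cy Cz xyz.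
move=> y; rewrite -{1}xP =>
  /(_ [set y | C y /\ exists2 z, C z & open_segment y z x]) []//.
split; first exact: open_segment_extendible_face.
(* [x] belongs to this face as the midpoint of the degenerate segment from [x] to [x]. *)
split=> //; exists x => //; exists 2^-1; first by apply/andP; split; lra.
by rewrite -scalerDl subrKC scale1r.
Qed.
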